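(* Let $R$ be an associative unital ring. The following conditions are equivalent. (i) $R$ is von Neumann regular. (ii) The zero complex is the only acyclic pure-minimal $R$-complex. (iii) An $R$-complex $M$ is pure-minimal if and only if the zero complex is the only acyclic subcomplex of $M$ (i.e., this equivalence holds for every $R$-complex $M$).
   Context: $R$-modules are left modules. An $R$-complex is a (possibly unbounded) chain complex $M$ of $R$-modules, indexed homologically; $Z_i(M)=\operatorname{Ker}(\partial_i^M)$; $\mathcal{C}(R)$ is the category of $R$-complexes and chain maps, with hom-sets $\operatorname{hom}_{\mathcal{C}(R)}(L,M)$. An exact sequence of $R$-modules is pure if $\operatorname{Hom}_R(A,-)$ leaves it exact for every finitely presented $R$-module $A$. A subcomplex $L\subseteq M$ is pure if $0\to\operatorname{hom}_{\mathcal{C}(R)}(A,L)\to\operatorname{hom}_{\mathcal{C}(R)}(A,M)\to\operatorname{hom}_{\mathcal{C}(R)}(A,M/L)\to 0$ is exact for every bounded complex $A$ of finitely presented $R$-modules. An $R$-complex $M$ is pure-acyclic if it is acyclic and $0\to Z_i(M)\to M_i\to Z_{i-1}(M)\to 0$ is a pure exact sequence of $R$-modules for every $i\in\mathbb{Z}$. An $R$-complex is pure-minimal if the zero complex is its only pure-acyclic pure subcomplex. *)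

(* Defs.v *)
From HB Require Import structures.
From mathcomp Require Import all_boot all_order all_algebra.

Set Implicit Arguments.
Unset Strict Implicit.
Unset Printing Implicit Defensive.

Import GRing.Theory.
Local Open Scope ring_scope.
Local Open Scope quotient_scope.

(* Rings are [pzRingType]s, so the zero ring is allowed. Submodules are bundled
   boolean predicates [submodClosed V]; classically, every submodule is of this
   form. *)

Definition von_neumann_regular (R : pzRingType) : Prop :=
  forall a : R, exists x : R, a * x * a = a.

Section Submodule.
Variables (R : pzRingType) (V : lmodType R) (S : submodClosed V).

Definition submod : Type := {x : V | x \in S}.
HB.instance Definition _ := SubChoice.on submod.
HB.instance Definition _ := [SubChoice_isSubLmodule of submod by <:].

Definition submod_incl (x : submod) : V := val x.

Fact submod_incl_is_linear : linear submod_incl.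
Proof. by move=> a x y; rewrite /submod_incl linearP. Qed.
HB.instance Definition _ :=
  GRing.isLinear.Build R submod V _ submod_incl submod_incl_is_linear.

End Submodule.

Section QuotientModule.
Variables (R : pzRingType) (V : lmodType R) (S : submodClosed V).

Definition submod_zmod : {pred V} := S.
HB.instance Definition _ := GRing.isZmodClosed.Build V submod_zmod
  (GRing.submod_closedB (submodClosedP S)).

(* The library's quotient of the additive group of V by S, to which the scalar
   multiplication is added. *)
Definition quotmod : Type := Quotient.quot submod_zmod.
HB.instance Definition _ := GRing.Zmodule.on quotmod.

Definition quot_proj (x : V) : quotmod := \pi_(Quotient.quot submod_zmod) x.
Definition quot_repr (x : quotmod) : V := repr x.

Fact quot_reprK : cancel quot_repr quot_proj.
Proof. exact: reprK. Qed.

Fact quot_projP x y : (quot_proj x = quot_proj y) <-> (x - y \in S).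
Proof.
have E := Quotient.idealrBE submod_zmod x y.
by split=> [/eqP|]; [rewrite -E | move=> H; apply/eqP; rewrite -E].
Qed.

Fact quot_projD x y : quot_proj (x + y) = quot_proj x + quot_proj y.
Proof. by rewrite /quot_proj piE. Qed.

Definition quot_scale (a : R) (x : quotmod) : quotmod :=
  quot_proj (a *: quot_repr x).

Fact quot_projZ a x : quot_proj (a *: x) = quot_scale a (quot_proj x).
Proof.
apply/quot_projP; rewrite -scalerBr rpredZ //.
by apply/quot_projP; rewrite quot_reprK.
Qed.

Fact quot_scaleA a b x : quot_scale a (quot_scale b x) = quot_scale (a * b) x.
Proof. by rewrite -[x]quot_reprK -!quot_projZ scalerA. Qed.
Fact quot_scale1 : left_id 1 quot_scale.
Proof. by move=> x; rewrite -[x]quot_reprK -!quot_projZ scale1r. Qed.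
Fact quot_scaleDr : right_distributive quot_scale +%R.
Proof.
move=> a x y; rewrite -[x]quot_reprK -[y]quot_reprK.
by rewrite -quot_projD -!quot_projZ -quot_projD scalerDr.
Qed.
Fact quot_scaleDl x : {morph quot_scale^~ x : a b / a + b}.
Proof.
by move=> a b /=; rewrite -[x]quot_reprK -!quot_projZ -quot_projD scalerDl.
Qed.
HB.instance Definition _ := GRing.Zmodule_isLmodule.Build R quotmod
  quot_scaleA quot_scale1 quot_scaleDr quot_scaleDl.

Fact quot_proj_is_linear : linear quot_proj.
Proof. by move=> a x y; rewrite quot_projD quot_projZ. Qed.
HB.instance Definition _ :=
  GRing.isLinear.Build R V quotmod _ quot_proj quot_proj_is_linear.

End QuotientModule.

Section InducedMaps.
Variables (R : pzRingType) (V W : lmodType R) (f : {linear V -> W}).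

Definition ker_pred : {pred V} := fun x => f x == 0.

Fact ker_pred_closed : submod_closed ker_pred.
Proof.
split=> [|a x y]; rewrite !unfold_in /ker_pred; first by rewrite linear0.
by rewrite linearP => /eqP -> /eqP ->; rewrite scaler0 addr0.
Qed.
HB.instance Definition _ := GRing.isSubmodClosed.Build R V ker_pred
  ker_pred_closed.

Definition corestr (T : submodClosed W) (fT : forall x, f x \in T) (x : V) :
  submod T := Sub (f x) (fT x).

Fact corestr_is_linear T fT : linear (@corestr T fT).
Proof. by move=> a x y; apply: val_inj; rewrite /= !linearP. Qed.
HB.instance Definition _ T fT :=
  GRing.isLinear.Build R V (submod T) _ (@corestr T fT) (corestr_is_linear fT).

Variables (S : submodClosed V) (T : submodClosed W).
Hypothesis fST : forall x, x \in S -> f x \in T.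

Definition restr (x : submod S) : submod T :=
  Sub (f (val x)) (fST (valP x)).

Fact restr_is_linear : linear restr.
Proof. by move=> a x y; apply: val_inj; rewrite /= !linearP. Qed.
HB.instance Definition _ :=
  GRing.isLinear.Build R (submod S) (submod T) _ restr restr_is_linear.

(* [fST] is not needed to define the function, but the linear structure, which
   depends on it, is inferred from this term. *)
Definition quot_map of (forall x, x \in S -> f x \in T) :=
  fun x : quotmod S => quot_proj T (f (quot_repr x)).

Fact quot_mapE x : quot_map fST (quot_proj S x) = quot_proj T (f x).
Proof.
apply/quot_projP; rewrite -linearB fST //.
by apply/quot_projP; rewrite quot_reprK.
Qed.

Fact quot_map_is_linear : linear (quot_map fST).
Proof.
move=> a x y; rewrite -[x]quot_reprK -[y]quot_reprK.
by rewrite -linearP !quot_mapE !linearP.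
Qed.
HB.instance Definition _ := GRing.isLinear.Build R (quotmod S) (quotmod T) _
  (quot_map fST) quot_map_is_linear.

End InducedMaps.

Arguments corestr {R V W} f {T} fT x.
Arguments restr {R V W} f {S T} fST x.
Arguments quot_map {R V W} f {S T} fST x.

Section PureExactness.
Variable R : pzRingType.

Definition finitely_presented (A : lmodType R) : Prop :=
  exists (m n : nat) (r : {linear 'rV[R]_m -> 'rV[R]_n})
         (p : {linear 'rV[R]_n -> A}),
    (forall a, exists x, p x = a) /\
    (forall x, p x = 0 <-> exists y, r y = x).

Definition short_exact (U V W : lmodType R)
    (f : {linear U -> V}) (g : {linear V -> W}) : Prop :=
  [/\ injective f,
      (forall v, g v = 0 <-> exists u, f u = v)
    & (forall w, exists v, g v = w)].

(* 0 -> Hom(A, U) -> Hom(A, V) -> Hom(A, W) -> 0 is exact *)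
Definition hom_short_exact (A U V W : lmodType R)
    (f : {linear U -> V}) (g : {linear V -> W}) : Prop :=
  [/\ (forall h k : {linear A -> U}, f \o h =1 f \o k -> h =1 k),
      (forall h : {linear A -> V},
         (g \o h =1 fun=> 0) <-> (exists k : {linear A -> U}, f \o k =1 h))
    & (forall h : {linear A -> W}, exists k : {linear A -> V}, g \o k =1 h)].

Definition pure_short_exact (U V W : lmodType R)
    (f : {linear U -> V}) (g : {linear V -> W}) : Prop :=
  short_exact f g /\
  forall A : lmodType R, finitely_presented A -> hom_short_exact A f g.

End PureExactness.

Section Complexes.
Variable R : pzRingType.

Record complex := Complex {
  obj :> int -> lmodType R;
  diff : forall i : int, {linear obj i -> obj (i - 1)};
  diff_diff : forall (i : int) (x : obj i), diff (i - 1) (diff i x) = 0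
}.

Record chain_map (M N : complex) := ChainMap {
  cmap :> forall i : int, {linear M i -> N i};
  cmap_diff : forall (i : int) (x : M i),
    cmap (i - 1) (diff M i x) = diff N i (cmap i x)
}.

Definition is_zero (M : complex) : Prop := forall (i : int) (x : M i), x = 0.

Definition cycles (M : complex) (i : int) : submodClosed (M i) :=
  ker_pred (diff M i).

(* Exactness at M_(i - 1), for every i. *)
Definition acyclic (M : complex) : Prop :=
  forall (i : int) (z : M (i - 1)), z \in cycles M (i - 1) ->
    exists x : M i, diff M i x = z.

Fact diff_in_cycles (M : complex) (i : int) (x : M i) :
  diff M i x \in cycles M (i - 1).
Proof. by rewrite unfold_in diff_diff eqxx. Qed.

Definition pure_acyclic (M : complex) : Prop :=
  acyclic M /\
  forall i : int,
    pure_short_exact (@submod_incl R (M i) (cycles M i))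
                     (corestr (diff M i) (@diff_in_cycles M i)).

(* Subcomplexes are identified with their families of underlying submodules. *)
Record subcomplex (M : complex) := Subcomplex {
  sub_obj :> forall i : int, submodClosed (M i);
  sub_diff : forall (i : int) (x : M i),
    x \in sub_obj i -> diff M i x \in sub_obj (i - 1)
}.

Section SubQuotient.
Variables (M : complex) (L : subcomplex M).

Definition sub_complex_diff (i : int) :
  {linear submod (L i) -> submod (L (i - 1))} :=
  restr (diff M i) (@sub_diff M L i).

Fact sub_complex_diff_diff (i : int) (x : submod (L i)) :
  sub_complex_diff (i - 1) (sub_complex_diff i x) = 0.
Proof. by apply: val_inj; rewrite /= diff_diff. Qed.

Definition sub_complex : complex := Complex sub_complex_diff_diff.

Definition quot_complex_diff (i : int) :
  {linear quotmod (L i) -> quotmod (L (i - 1))} :=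
  quot_map (diff M i) (@sub_diff M L i).

Fact quot_complex_diff_diff (i : int) (x : quotmod (L i)) :
  quot_complex_diff (i - 1) (quot_complex_diff i x) = 0.
Proof.
rewrite -[x]quot_reprK /= (quot_mapE (@sub_diff M L i)).
by rewrite (quot_mapE (@sub_diff M L (i - 1))) diff_diff linear0.
Qed.

Definition quot_complex : complex := Complex quot_complex_diff_diff.

Fact sub_incl_diff (i : int) (x : sub_complex i) :
  submod_incl (diff sub_complex i x) = diff M i (submod_incl x).
Proof. by []. Qed.

Definition sub_incl : chain_map sub_complex M :=
  @ChainMap sub_complex M (fun i => @submod_incl R (M i) (L i)) sub_incl_diff.

Fact quot_complex_proj_diff (i : int) (x : M i) :
  quot_proj (L (i - 1)) (diff M i x) =
  diff quot_complex i (quot_proj (L i) x).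
Proof. by rewrite /= (quot_mapE (@sub_diff M L i)). Qed.

Definition quot_complex_proj : chain_map M quot_complex :=
  @ChainMap M quot_complex (fun i => @quot_proj R (M i) (L i))
    quot_complex_proj_diff.

End SubQuotient.

Definition bounded (A : complex) : Prop :=
  exists n : int, forall i : int, n < `|i| -> forall x : A i, x = 0.

Definition chain_hom_short_exact (A L M N : complex)
    (f : chain_map L M) (g : chain_map M N) : Prop :=
  [/\ (forall h k : chain_map A L,
         (forall i, f i \o h i =1 f i \o k i) -> forall i, h i =1 k i),
      (forall h : chain_map A M,
         (forall i, g i \o h i =1 fun=> 0) <->
         (exists k : chain_map A L, forall i, f i \o k i =1 h i))
    & (forall h : chain_map A N,
         exists k : chain_map A M, forall i, g i \o k i =1 h i)].

Definition pure_subcomplex (M : complex) (L : subcomplex M) : Prop :=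
  forall A : complex, bounded A -> (forall i, finitely_presented (A i)) ->
    chain_hom_short_exact A (sub_incl L) (quot_complex_proj L).

Definition pure_minimal (M : complex) : Prop :=
  forall L : subcomplex M,
    (pure_acyclic (sub_complex L) /\ pure_subcomplex L) <->
    is_zero (sub_complex L).

End Complexes.

(* Main.v *)
Require Import Defs.
From mathcomp Require Import all_boot all_order all_algebra.
From HB Require Import structures.
From mathcomp Require Import boolp classical_sets zify.

(** Three implications give the equivalence.

    If R is von Neumann regular, then so are all matrices over R, hence the
    finitely presented modules are projective ([fp_projective]). Every short
    exact sequence is then pure, so acyclic complexes are pure-acyclic
    ([regular_acyclic_pure]). Moreover an acyclic subcomplex L of M is always
    pure ([regular_acyclic_pure_subcomplex]): the obstruction to lifting a chain
    map from A to M/L consists of maps from the projective modules A_i to the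
    cycles of L, which factor through the differential of L. The pure-acyclic
    pure subcomplexes are therefore exactly the acyclic ones, and this gives the
    third condition.

    The third condition implies the second one, because an acyclic complex is an
    acyclic subcomplex of itself.

    Assume finally that the acyclic pure-minimal complexes are zero, and let M
    be acyclic. By Zorn's lemma M has a subcomplex L which is maximal for the
    part of being pure-acyclic and pure that the cyclic modules R/Rc detect
    ([cyclic_pure]). This elementwise property passes to unions of chains, and
    to the preimage of a pure-acyclic pure subcomplex of M/L
    ([preim_cyclic_pure]), so M/L is pure-minimal. It is also acyclic, hence
    zero, so M has the property ([acyclic_lift_ann]): a cycle killed by c is
    the boundary of an element killed by c. For M built from
    0 -> Ra -> R -> R/Ra -> 0 and c = a, this lifts the class of 1 in R/Ra to
    some 1 + r a with a (1 + r a) = 0, so that a (- r) a = a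
    ([minimal_acyclic_regular]). *)

Set Implicit Arguments.
Unset Strict Implicit.
Unset Printing Implicit Defensive.

Import Order.TTheory GRing.Theory Num.Theory.
Local Open Scope ring_scope.

(** * Construction of linear maps *)

Section LinearMaps.
Variable R : pzRingType.
Implicit Types U V W A : lmodType R.

Lemma linear_exists V W (f : V -> W) :
  linear f -> exists k : {linear V -> W}, k =1 f.
Proof.
move=> lf.
pose k : {linear V -> W} := HB.pack f (GRing.isLinear.Build R V W _ f lf).
by exists k.
Qed.

(** Choosing values through preimages gives no linearity by itself; it follows
    from uniqueness when the graph is a submodule. *)
Lemma linear_of_rel V W (P : V -> W -> Prop) :
    (forall v, exists w, P v w) ->
    (forall v w w', P v w -> P v w' -> w = w') ->
    (forall c v v' w w', P v w -> P v' w' -> P (c *: v + v') (c *: w + w')) ->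
  exists k : {linear V -> W}, forall v, P v (k v).
Proof.
move=> /choice[f fP] P_fun P_lin.
have /linear_exists[k kE] : linear f.
  by move=> c v v'; apply: P_fun (P_lin _ _ _ _ _ (fP v) (fP v')).
by exists k => v; rewrite kE.
Qed.

Lemma factor_surj V A W (p : {linear V -> A}) (f : {linear V -> W}) :
    (forall a, exists x, p x = a) -> (forall x, p x = 0 -> f x = 0) ->
  exists k : {linear A -> W}, forall x, k (p x) = f x.
Proof.
move=> p_surj kerpf.
have [||| k kP] := @linear_of_rel A W (fun a w => exists2 x, p x = a & f x = w).
- by move=> a; have [x <-] := p_surj a; exists (f x), x.
- move=> a w w' [x <- <-] [x' px' <-]; apply/eqP; rewrite -subr_eq0 -linearB.
  by rewrite kerpf // linearB px' subrr.
- move=> c a a' w w' [x <- <-] [x' <- <-].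
  by exists (c *: x + x'); rewrite linearP.
exists k => x; have [x' px' <-] := kP (p x); apply/eqP.
by rewrite -subr_eq0 -linearB kerpf // linearB px' subrr.
Qed.

Lemma factor_inj A U V (f : {linear U -> V}) (h : {linear A -> V}) :
    injective f -> (forall a, exists u, f u = h a) ->
  exists k : {linear A -> U}, forall a, f (k a) = h a.
Proof.
move=> f_inj fh; apply: linear_of_rel fh _ _ => [a u u' <- /f_inj //|].
by move=> c a a' u u' fu fu'; rewrite !linearP fu fu'.
Qed.

Lemma free_lift n V W (g : {linear V -> W}) (h : {linear 'rV[R]_n -> W}) :
    (forall w, exists v, g v = w) ->
  exists f : {linear 'rV[R]_n -> V}, forall x, g (f x) = h x.
Proof.
move=> g_surj.
have /choice[v gv] (i : 'I_n) := g_surj (h (delta_mx 0 i)).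
have /linear_exists[f fE] : linear (fun x : 'rV[R]_n => \sum_i x 0 i *: v i).
  move=> c x y; rewrite scaler_sumr -big_split; apply: eq_bigr => i _.
  by rewrite !mxE scalerDl scalerA.
exists f => x; rewrite fE linear_sum {2}[x]row_sum_delta linear_sum.
by apply: eq_bigr => i _; rewrite !linearZ /= gv.
Qed.

Lemma short_exact_left A U V W (f : {linear U -> V}) (g : {linear V -> W}) :
    short_exact f g ->
  (forall h k : {linear A -> U}, f \o h =1 f \o k -> h =1 k) /\
  (forall h : {linear A -> V},
     (g \o h =1 fun=> 0) <-> (exists k : {linear A -> U}, f \o k =1 h)).
Proof.
case=> f_inj fg _; split=> [h k hk a | h]; first exact/f_inj/hk.
split=> [gh | [k kE] a]; first by apply: factor_inj => // a; apply/fg/gh.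
by rewrite /= -kE; apply/fg; exists (k a).
Qed.

End LinearMaps.

(** * Finitely presented modules over a von Neumann regular ring *)

Section RegularMatrices.
Variable R : pzRingType.

Definition regular_mx m n (C : 'M[R]_(m, n)) := exists X, C *m X *m C = C.

(** Von Neumann's lemma. If Y is a quasi-inverse of
    C - C X C = C (1 - X C) = (1 - C X) C, then
    X + (1 - X C) Y (1 - C X) is one of C. *)
Lemma regular_mx_sub m n (C : 'M[R]_(m, n)) X :
  regular_mx (C - C *m X *m C) -> regular_mx C.
Proof.
move=> [Y]; set D := C - _ => DY.
exists (X + (1%:M - X *m C) *m Y *m (1%:M - C *m X)).
have DE : D = C *m (1%:M - X *m C) by rewrite mulmxBr mulmx1 mulmxA.
have DE' : D = (1%:M - C *m X) *m C by rewrite mulmxBl mul1mx.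
rewrite mulmxDr mulmxDl !mulmxA -DE -[X in _ + X]mulmxA -DE' DY.
by rewrite addrC subrK.
Qed.

(** With X a quasi-inverse of A, the matrix (X; 0) is one of (A B) up to the
    error (0, B - A X B), which has a single nonzero block. *)
Lemma regular_row_mx m n1 n2 (A : 'M[R]_(m, n1)) (B : 'M[R]_(m, n2)) :
    regular_mx A -> (forall E : 'M[R]_(m, n2), regular_mx E) ->
  regular_mx (row_mx A B).
Proof.
move=> [X AX] reg; apply: (@regular_mx_sub _ _ _ (col_mx X 0)).
rewrite mul_row_col mulmx0 addr0 mul_mx_row AX opp_row_mx add_row_mx subrr.
have [Y EY] := reg (B - A *m X *m B); exists (col_mx 0 Y).
by rewrite mul_row_col mulmx0 add0r mul_mx_row mulmx0 EY.
Qed.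

Lemma regular_col_mx m1 m2 n (A : 'M[R]_(m1, n)) (B : 'M[R]_(m2, n)) :
    regular_mx A -> (forall E : 'M[R]_(m2, n), regular_mx E) ->
  regular_mx (col_mx A B).
Proof.
move=> [X AX] reg; apply: (@regular_mx_sub _ _ _ (row_mx X 0)).
rewrite -mulmxA mul_row_col mul0mx addr0 mul_col_mx !mulmxA AX.
rewrite opp_col_mx add_col_mx subrr.
have [Y EY] := reg (B - B *m X *m A); exists (row_mx 0 Y).
by rewrite -mulmxA mul_row_col mul0mx add0r mul_col_mx mul0mx mulmxA EY.
Qed.

(** Bordering by one row, then by one column, at a time. *)
Lemma von_neumann_regular_mx :
  von_neumann_regular R -> forall m n (C : 'M[R]_(m, n)), regular_mx C.
Proof.
move=> reg m n.
have reg1 (C : 'M[R]_1) : regular_mx C.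
  have [x xP] := reg (C 0 0); exists x%:M.
  by rewrite [C]mx11_scalar -!scalar_mxM xP.
have regc (C : 'cV[R]_m) : regular_mx C.
  elim: m C => [|m IH] C; first by exists 0; apply/matrixP=> -[].
  suff: @regular_mx (1 + m) 1 C by [].
  by rewrite -(@vsubmxK _ 1 m 1 C); apply: regular_col_mx.
elim: n => [|n IH] C; first by exists 0; apply/matrixP=> i [].
suff: @regular_mx m (1 + n) C by [].
by rewrite -(@hsubmxK _ m 1 n C); apply: regular_row_mx.
Qed.

(** If X is a quasi-inverse of the matrix of the presentation
    r : R^m -> R^n of A, then 1 - r X kills the image of r, so it induces a
    section A -> R^n of the projection. The lift of A -> W is this section
    followed by a lift R^n -> V of the composite R^n -> A -> W. *)
Lemma fp_projective (A V W : lmodType R)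
    (g : {linear V -> W}) (h : {linear A -> W}) :
    von_neumann_regular R -> finitely_presented A ->
    (forall w, exists v, g v = w) ->
  exists k : {linear A -> V}, g \o k =1 h.
Proof.
move=> reg [m [n [r [p [p_surj ker_p]]]]] g_surj.
have [X XP] := von_neumann_regular_mx reg (lin1_mx r).
have [f fP] := free_lift (h \o p) g_surj.
pose q (x : 'rV[R]_n) : 'rV_m := x *m X.
have rq y : r (q (r y)) = r y.
  by rewrite -![r _]mul_rV_lin1 /q -!mulmxA -[lin1_mx r in RHS]XP !mulmxA.
have pr y : p (r y) = 0 by apply/ker_p; exists y.
have /linear_exists[s sE] : linear (fun x => f (x - r (q x))).
  move=> c x y; rewrite /q mulmxDl -scalemxAl -[RHS]linearP; congr (f _).
  by rewrite linearP scalerBr opprD addrACA.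
have [|k kP] := factor_surj (p := p) (f := s) p_surj.
  by move=> x /ker_p[y <-]; rewrite sE rq subrr linear0.
exists k => a; have [x <-] := p_surj a.
by rewrite /= kP sE fP /= linearB pr subr0.
Qed.

End RegularMatrices.

(** * Pure subcomplexes *)

Section Complexes.
Variable R : pzRingType.
Implicit Types M A : complex R.

Lemma submodN (V : lmodType R) (S : submodClosed V) (x : V) :
  x \in S -> - x \in S.
Proof. by move=> Sx; rewrite -scaleN1r rpredZ. Qed.

Lemma submodB (V : lmodType R) (S : submodClosed V) (x y : V) :
  x \in S -> y \in S -> x - y \in S.
Proof. by move=> Sx Sy; rewrite rpredD ?submodN. Qed.

Lemma quot_proj_eq0 (V : lmodType R) (S : submodClosed V) (x : V) :
  quot_proj S x = 0 <-> x \in S.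
Proof. by rewrite -[0](linear0 (quot_proj S)) quot_projP subr0. Qed.

Lemma acyclic_short_exact M i :
  acyclic M -> short_exact (@submod_incl R (M i) (cycles M i))
                           (corestr (diff M i) (@diff_in_cycles R M i)).
Proof.
move=> acM; split=> [|v|w]; first exact: val_inj.
- split=> [/(congr1 val)/= dv|[u <-]].
    by exists (Sub v (introT eqP dv)).
  by apply: val_inj; apply/eqP: (valP u).
- have [v dv] := acM i (val w) (valP w).
  by exists v; apply: val_inj.
Qed.

Lemma zero_acyclic M : is_zero M -> acyclic M.
Proof. by move=> M0 i z _; exists 0; rewrite [z]M0 linear0. Qed.

Lemma zero_pure_acyclic M : is_zero M -> pure_acyclic M.
Proof.
move=> M0; have acM := zero_acyclic M0; split=> // i.
have ex := acyclic_short_exact i acM; split=> // A _.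
have [inj ker] := short_exact_left A ex; split=> // h.
by exists \0 => a; apply: val_inj; rewrite [LHS]M0 [RHS]M0.
Qed.

(** The first two conditions of purity: the functor of chain maps from A is left
    exact, so only the lifting of chain maps to the quotient is at stake. *)
Lemma subcomplex_left A M (L : subcomplex M) :
  (forall h k : chain_map A (sub_complex L),
     (forall i, sub_incl L i \o h i =1 sub_incl L i \o k i) ->
     forall i, h i =1 k i) /\
  (forall h : chain_map A M,
     (forall i, quot_complex_proj L i \o h i =1 fun=> 0) <->
     (exists k : chain_map A (sub_complex L),
        forall i, sub_incl L i \o k i =1 h i)).
Proof.
split=> [h k hk i a | h]; first exact/val_inj/hk.
split=> [h0 | [k kE] i a]; last first.
  by rewrite /= -kE; apply/quot_proj_eq0/valP.
have hL i a : h i a \in L i by apply/quot_proj_eq0/h0.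
have k_diff i (a : A i) : corestr (h (i - 1)) (hL (i - 1)) (diff A i a) =
    diff (sub_complex L) i (corestr (h i) (hL i) a).
  by apply: val_inj; rewrite /= cmap_diff.
by exists (@ChainMap _ A (sub_complex L) _ k_diff).
Qed.

Lemma zero_pure_subcomplex M (L : subcomplex M) :
  is_zero (sub_complex L) -> pure_subcomplex L.
Proof.
move=> L0 A _ _; have [inj ker] := subcomplex_left A L; split=> // h.
have L_eq0 i (x : M i) : x \in L i -> x = 0.
  by move=> Lx; have /(congr1 val) := L0 i (Sub x Lx).
have proj_inj i : injective (@quot_proj R (M i) (L i)).
  by move=> x y /quot_projP/L_eq0/eqP; rewrite subr_eq0 => /eqP.
have /(_ _)/cid-lift i : exists k : {linear A i -> M i},
    forall a : A i, quot_proj (L i) (k a) = h i a.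
  apply: (factor_inj (h := h i) (@proj_inj i)) => a.
  by exists (quot_repr (h i a)); apply: quot_reprK.
pose k i := projT1 (lift i).
have kE i (a : A i) : quot_proj (L i) (k i a) = h i a := projT2 (lift i) a.
have k_diff i (a : A i) : k (i - 1) (diff A i a) = diff M i (k i a).
  by apply: proj_inj; rewrite kE cmap_diff -kE quot_complex_proj_diff.
by exists (ChainMap k_diff) => i a; apply: kE.
Qed.

Lemma zero_pure_minimal M : is_zero M -> pure_minimal M.
Proof.
move=> M0 L; have L0 : is_zero (sub_complex L).
  by move=> i x; apply/val_inj/M0.
split=> // _.
by split; [apply: zero_pure_acyclic | apply: zero_pure_subcomplex].
Qed.

Lemma full_sub_closed (V : lmodType R) : submod_closed [pred x : V | true].
Proof. by []. Qed.
HB.instance Definition _ V :=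
  GRing.isSubmodClosed.Build R V [pred x : V | true] (full_sub_closed V).

Definition full_subcomplex M : subcomplex M :=
  @Subcomplex R M (fun i => [pred x : M i | true] : submodClosed (M i))
    (fun i x _ => isT).

(** * Acyclic complexes over a von Neumann regular ring *)

Section Regular.
Hypothesis reg : von_neumann_regular R.

Lemma regular_acyclic_pure M : acyclic M -> pure_acyclic M.
Proof.
move=> acM; split=> // i; have ex := acyclic_short_exact i acM.
split=> // A fpA; have [inj ker] := short_exact_left A ex; split=> // h.
by apply: fp_projective => //; case: ex.
Qed.

(** A chain map h from A to M/L lifts degreewise because the A_i are projective.
    The lifts are corrected one degree at a time, from the bottom of A upwards:
    if k commutes with the differentials below degree j, the defect
    d k_j - k_(j-1) d takes values in the cycles of L, because h is a chain map
    and k commutes with d in degree j - 1; as L is acyclic and A_j projective,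
    it equals d e for some e : A_j -> L_j, and k_j - e is the corrected lift. *)
Lemma regular_acyclic_pure_subcomplex M (L : subcomplex M) :
  acyclic (sub_complex L) -> pure_subcomplex L.
Proof.
move=> acL A [N A0] fpA; have [inj ker] := subcomplex_left A L; split=> // h.
have proj_surj i (w : quotmod (L i)) : exists v, quot_proj (L i) v = w.
  by exists (quot_repr w); rewrite quot_reprK.
suff lift (n : nat) : exists2 k : forall i, {linear A i -> M i},
    forall i (a : A i), quot_proj (L i) (k i a) = h i a &
    forall i, i < n%:Z - N -> forall a : A i,
      k (i - 1) (diff A i a) = diff M i (k i a).
  (* Above degree N the complex A vanishes. *)
  have [k kE k_diff] := lift `|(N + N + 1)%R|%N.
  suff k_diff' i (a : A i) : k (i - 1) (diff A i a) = diff M i (k i a).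
    by exists (ChainMap k_diff') => i a; apply: kE.
  have [/A0 Ai0 | iN] := ltP N `|i|; first by rewrite [a]Ai0 !linear0.
  by apply: k_diff; lia.
elim: n => [|n [k kE k_diff]].
  (* Below degree - N the complex A vanishes. *)
  have /(_ _)/cid-lift i := fp_projective (h i) reg (fpA i) (@proj_surj i).
  exists (fun i => projT1 (lift i)) => [i a | i iN a].
    exact: (projT2 (lift i) a).
  have Ai0 : a = 0 by apply: A0; lia.
  by rewrite Ai0 !linear0.
set j : int := n%:Z - N.
pose del := (diff M j \o k j) \- (k (j - 1) \o diff A j).
have del_L a : del a \in L (j - 1).
  have := kE (j - 1) (diff A j a).
  by rewrite cmap_diff -kE -quot_complex_proj_diff => /esym/quot_projP.
pose delL := corestr del del_L.
have delZ a : delL a \in cycles (sub_complex L) (j - 1).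
  apply/eqP/val_inj; rewrite /= linearB diff_diff sub0r -k_diff.
    by rewrite diff_diff linear0 oppr0.
  by rewrite /j ltrBlDr ltrDl.
have [e eE] := fp_projective (corestr delL delZ) reg (fpA j)
  (let: And3 _ _ s := acyclic_short_exact j acL in s).
have dE a : diff M j (val (e a)) = del a := congr1 (val \o val) (eE a).
pose kj : {linear A j -> M j} := k j \- (@submod_incl R (M j) (L j) \o e).
exists (dfwith k kj) => [i a | i iN a].
  have [jE | ji] := eqVneq j i; last by rewrite dfwith_out.
  case: i / jE a => a.
  rewrite dfwith_in -kE; apply/quot_projP => /=.
  by rewrite addrAC subrr sub0r; apply/submodN/(valP (e a)).
have [jE | ji] := eqVneq j i.
  case: i / jE iN a => _ a.
  rewrite dfwith_in dfwith_out; last by lia.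
  by rewrite /= linearB dE subKr.
by rewrite !dfwith_out //; [apply: k_diff; lia | lia].
Qed.

End Regular.

End Complexes.

(** * Purity tested on cyclic modules and on discs *)

Section CyclicModules.
Variable R : pzRingType.

Definition principal (c : R) : {pred R^o} :=
  fun x => `[< exists r, x = r * c >].

Lemma principalP c x : reflect (exists r, x = r * c) (x \in principal c).
Proof. exact: asboolP. Qed.

Lemma principal_closed c : submod_closed (principal c).
Proof.
split=> [|r x y /principalP[s ->] /principalP[t ->]]; apply/principalP.
  by exists 0; rewrite mul0r.
by exists (r * s + t); rewrite mulrDl -mulrA.
Qed.
HB.instance Definition _ c :=
  GRing.isSubmodClosed.Build R R^o (principal c) (principal_closed c).

Definition cyclic_mod c : lmodType R :=
  quotmod (principal c : submodClosed R^o).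
Definition cyclic_class c (r : R) : cyclic_mod c := quot_proj (principal c) r.

Lemma cyclic_mod_fp c : finitely_presented (cyclic_mod c).
Proof.
have /linear_exists[r rE] :
    linear (fun x : 'rV[R]_1 => \row_(j < 1) (x 0 0 * c) : 'rV[R]_1).
  by move=> s x y; apply/rowP => j; rewrite !mxE mulrDl mulrA.
have /linear_exists[p pE] :
    linear (fun x : 'rV[R]_1 => cyclic_class c (x 0 0)).
  by move=> s x y; rewrite !mxE -linearP.
exists 1%N, 1%N, r, p; split=> [w | x].
  exists (\row_(j < 1) quot_repr w); rewrite pE mxE; exact: quot_reprK.
rewrite pE; split=> [/quot_proj_eq0/principalP[s xE] | [y <-]].
  by exists s%:M; rewrite rE; apply/rowP => j; rewrite !mxE ord1 xE eqxx.
by apply/quot_proj_eq0/principalP; exists (y 0 0); rewrite rE mxE.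
Qed.

Lemma cyclic_mod_map c (V : lmodType R) (v : V) :
    c *: v = 0 ->
  exists k : {linear cyclic_mod c -> V},
    forall r, k (cyclic_class c r) = r *: v.
Proof.
move=> cv0.
have /linear_exists[f fE] : linear (fun r : R^o => (r : R) *: v : V).
  by move=> s x y; rewrite scalerDl scalerA.
have [||k kE] :=
  @factor_surj R R^o (cyclic_mod c) V (quot_proj (principal c)) f.
- by move=> w; exists (quot_repr w); apply: quot_reprK.
- by move=> x /quot_proj_eq0/principalP[r ->]; rewrite fE -scalerA cv0 scaler0.
by exists k => r; rewrite kE fE.
Qed.

Lemma cyclic_class_ann c : c *: cyclic_class c 1 = 0.
Proof.
rewrite -[LHS](quot_projZ (principal c)); apply/quot_proj_eq0/principalP.
by exists 1; rewrite mul1r [LHS]mulr1.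
Qed.

(** Purity tested on R/Rc: a linear map from R/Rc is an element killed by c. *)
Lemma pure_lift_ann (U V W : lmodType R)
    (f : {linear U -> V}) (g : {linear V -> W}) c (w : W) :
  pure_short_exact f g -> c *: w = 0 -> exists2 v, g v = w & c *: v = 0.
Proof.
move=> [_ pure_fg] /cyclic_mod_map[h hE].
have [_ _ /(_ h)[k kE]] := pure_fg _ (cyclic_mod_fp c).
exists (k (cyclic_class c 1)).
  by rewrite -[LHS]/((g \o k) _) kE hE scale1r.
by rewrite -linearZ cyclic_class_ann linear0.
Qed.

End CyclicModules.

Section Disc.
Variables (R : pzRingType) (a : R) (j : int).

(** The disc on R/Ra: the complex R/Ra -> R/Ra, with identity differential, in
    degrees j and j - 1. Its zero terms are presented as R/R1, so that every
    term is a quotient of R and every differential is induced by a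
    multiplication. *)
Definition disc_ann (i : int) : R := if (i == j) || (i == j - 1) then a else 1.
Definition disc_coef (i : int) : R := (i == j)%:R.

Definition disc_mul i (x : R^o) : R^o := x * disc_coef i.

Lemma disc_mul_principal i (x : R^o) :
  x \in principal (disc_ann i) ->
  disc_mul i x \in principal (disc_ann (i - 1)).
Proof.
move=> /principalP[r ->]; apply/principalP.
rewrite /disc_ann /disc_mul /disc_coef.
have [->|_] := eqVneq i j; last by exists 0; rewrite mul0r mulr0.
by exists r; rewrite eqxx orbT mulr1.
Qed.

Lemma disc_mul_linear i : linear (disc_mul i).
Proof. by move=> r x y; rewrite /disc_mul mulrDl -mulrA. Qed.
HB.instance Definition _ i := GRing.isLinear.Build R R^o R^o _
  (disc_mul i) (disc_mul_linear i).

Definition disc_diff i :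
    {linear cyclic_mod (disc_ann i) -> cyclic_mod (disc_ann (i - 1))} :=
  quot_map (disc_mul i) (@disc_mul_principal i).

Lemma disc_diff_class i r :
  disc_diff i (cyclic_class (disc_ann i) r) = cyclic_class _ (r * disc_coef i).
Proof. exact: quot_mapE. Qed.

Lemma disc_diff_diff i (x : cyclic_mod (disc_ann i)) :
  disc_diff (i - 1) (disc_diff i x) = 0.
Proof.
rewrite -[x]quot_reprK -/(cyclic_class _ _) !disc_diff_class.
have -> : quot_repr x * disc_coef i * disc_coef (i - 1) = 0.
  rewrite /disc_coef -mulrA; case: eqP => [ij|_]; last by rewrite mul0r mulr0.
  have -> : (i - 1 == j) = false by lia.
  by rewrite !mulr0.
exact: linear0.
Qed.

Definition disc : complex R := Complex disc_diff_diff.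

Lemma cyclic_mod1 (x : cyclic_mod (1 : R)) : x = 0.
Proof.
rewrite -[x]quot_reprK; apply/quot_proj_eq0/principalP.
by exists (quot_repr x); rewrite mulr1.
Qed.

Lemma disc_bounded : bounded disc.
Proof.
exists (`|j| + 1) => i ij x.
move: x; rewrite /= /disc_ann.
have -> : (i == j) || (i == j - 1) = false by lia.
exact: cyclic_mod1.
Qed.

(** An element v of degree j killed by a is the image of the generator under a
    chain map from the disc: the generator of degree j - 1 goes to d v. *)
Lemma disc_map (M : complex R) (v : M j) :
  a *: v = 0 -> exists h : chain_map disc M,
    h j (cyclic_class _ 1) = v.
Proof.
move=> av0.
pose m := dfwith (dfwith (fun i => 0 : M i) (diff M j v)) v.
have mj : m j = v by rewrite /m dfwith_in.
have mj1 : m (j - 1) = diff M j v.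
  by rewrite /m dfwith_out ?dfwith_in //; lia.
have m0 i : i != j -> i != j - 1 -> m i = 0.
  by move=> ij ij1; rewrite /m !dfwith_out // eq_sym.
have ann i : disc_ann i *: m i = 0.
  rewrite /disc_ann; have [->|ij] /= := eqVneq i j; first by rewrite mj.
  have [->|ij1] := eqVneq i (j - 1); last by rewrite m0 ?scaler0.
  by rewrite mj1 -linearZ av0 linear0.
have m_diff i : disc_coef i *: m (i - 1) = diff M i (m i).
  rewrite /disc_coef; have [->|ij] := eqVneq i j.
    by rewrite scale1r mj mj1.
  rewrite scale0r; have [->|ij1] := eqVneq i (j - 1).
    by rewrite mj1 diff_diff.
  by rewrite m0 ?linear0.
have /(_ _)/cid-hP i := cyclic_mod_map (ann i).
pose h i := projT1 (hP i).
have hE i r : h i (cyclic_class _ r) = r *: m i := projT2 (hP i) r.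
have h_diff i (x : disc i) : h (i - 1) (diff disc i x) = diff M i (h i x).
  rewrite -[x]quot_reprK -/(cyclic_class _ _).
  by rewrite [diff _ _ _]disc_diff_class !hE linearZ -scalerA m_diff.
by exists (ChainMap h_diff); rewrite /= hE scale1r mj.
Qed.

Lemma disc_class_ann : a *: (cyclic_class _ 1 : disc j) = 0.
Proof.
have {1}<- : disc_ann j = a by rewrite /disc_ann eqxx.
exact: cyclic_class_ann.
Qed.

(** The class of v in M/L is killed by a, so it is the image of the generator
    under a chain map from the disc. A lift of this map to M provides u, killed
    by a and congruent to v modulo L, and l = v - u. *)
Lemma pure_sub_ann (M : complex R) (L : subcomplex M) (v : M j) :
  pure_subcomplex L -> a *: v \in L j ->
  exists2 l, l \in L j & a *: l = a *: v.
Proof.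
move=> pureL av.
have [|h hE] := @disc_map (quot_complex L) (quot_proj (L j) v).
  by rewrite -[LHS]quot_projZ; apply/quot_proj_eq0.
have [_ _ /(_ h)[k kE]] :=
  pureL disc disc_bounded (fun i => cyclic_mod_fp (disc_ann i)).
pose u := k j (cyclic_class _ 1).
have au : a *: u = 0 by rewrite -linearZ disc_class_ann linear0.
exists (v - u); last by rewrite scalerBr au subr0.
by apply/quot_projP; rewrite -hE -kE.
Qed.

End Disc.

(** * Maximal cyclically pure subcomplexes *)

Section CyclicPurity.
Variable R : pzRingType.
Implicit Types M : complex R.

(** An elementwise consequence of being a pure-acyclic pure subcomplex, stable
    under unions of chains and under extensions. The first field lifts the maps
    from R/Rc to the cycles of L along the differential of L; for c = 0 it says
    that L is acyclic. The second one lifts the maps from R/Rc to M_i/L_i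
    along M_i -> M_i/L_i. *)
Record cyclic_pure M (L : subcomplex M) : Prop := CyclicPure {
  cyclic_pure_lift : forall c i (w : M (i - 1)),
    w \in L (i - 1) -> diff M (i - 1) w = 0 -> c *: w = 0 ->
    exists v, [/\ v \in L i, diff M i v = w & c *: v = 0];
  cyclic_pure_div : forall c i (v : M i),
    c *: v \in L i -> exists2 l, l \in L i & c *: l = c *: v
}.

Definition zero_sub (V : lmodType R) : {pred V} := fun x => x == 0.
Lemma zero_sub_closed V : submod_closed (@zero_sub V).
Proof.
split=> [|c x y]; rewrite !unfold_in // => /eqP-> /eqP->.
by rewrite scaler0 addr0.
Qed.
HB.instance Definition _ V :=
  GRing.isSubmodClosed.Build R V (@zero_sub V) (@zero_sub_closed V).

Lemma zero_sub_diff M i (x : M i) :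
  x \in @zero_sub (M i) -> diff M i x \in @zero_sub (M (i - 1)).
Proof. by rewrite !unfold_in => /eqP ->; rewrite linear0. Qed.

Definition zero_subcomplex M : subcomplex M :=
  @Subcomplex R M (fun i => @zero_sub (M i) : submodClosed (M i))
    (@zero_sub_diff M).

Lemma zero_cyclic_pure M : cyclic_pure (zero_subcomplex M).
Proof.
split=> [c i w /eqP-> _ _ | c i v /eqP cv0].
  by exists 0; rewrite !linear0 scaler0; split=> //; apply: eqxx.
by exists 0; rewrite ?scaler0 //; apply: eqxx.
Qed.

Section ChainUnion.
Variables (M : complex R) (C : set (subcomplex M)).
Definition sub_le (K L : subcomplex M) := forall i x, x \in K i -> x \in L i.
Hypotheses (C_total : total_on C sub_le) (C_nonempty : exists L, C L).

Definition union_sub i : {pred M i} :=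
  fun x => `[< exists2 L, C L & x \in L i >].
Arguments union_sub : clear implicits.

Lemma union_subP i x : reflect (exists2 L, C L & x \in L i) (x \in union_sub i).
Proof. exact: asboolP. Qed.

Lemma union_sub_closed i : submod_closed (union_sub i).
Proof.
split=> [|c x y].
  have [L CL] := C_nonempty; apply/union_subP; exists L => //; exact: rpred0.
move=> /union_subP[K CK Kx] /union_subP[L CL Ly]; apply/union_subP.
have [/(_ _ _ Kx) Lx | /(_ _ _ Ly) Ky] := C_total CK CL.
  by exists L; rewrite // rpredD ?rpredZ.
by exists K; rewrite // rpredD ?rpredZ.
Qed.
HB.instance Definition _ i :=
  GRing.isSubmodClosed.Build R (M i) (union_sub i) (union_sub_closed i).

Lemma union_sub_diff i x :
  x \in union_sub i -> diff M i x \in union_sub (i - 1).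
Proof.
by case/union_subP=> L CL Lx; apply/union_subP; exists L => //; apply: sub_diff.
Qed.

Definition union_subcomplex : subcomplex M :=
  @Subcomplex R M (fun i => union_sub i : submodClosed (M i)) union_sub_diff.

Lemma union_cyclic_pure :
  (forall L, C L -> cyclic_pure L) -> cyclic_pure union_subcomplex.
Proof.
move=> C_pure; split=> [c i w /union_subP[L CL Lw] dw cw | c i v].
  have [v [Lv dv cv]] := cyclic_pure_lift (C_pure L CL) Lw dw cw.
  by exists v; split=> //; apply/union_subP; exists L.
case/union_subP=> L CL Lcv; have [l Ll lE] := cyclic_pure_div (C_pure L CL) Lcv.
by exists l => //; apply/union_subP; exists L.
Qed.

End ChainUnion.

Arguments sub_le {M} K L.

Lemma maximal_cyclic_pure M : exists2 L : subcomplex M, cyclic_pure L &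
  forall K, cyclic_pure K -> sub_le L K -> sub_le K L.
Proof.
pose T := {L : subcomplex M | cyclic_pure L}.
pose t0 : T := exist _ _ (zero_cyclic_pure M).
pose le (s t : T) := `[< sub_le (projT1 s) (projT1 t) >].
have [|r s t /asboolP rs /asboolP st|C C_total|[L pureL] L_max] :=
    @ZL_preorder T t0 le.
- by move=> t; apply/asboolP.
- by apply/asboolP => i x /rs/st.
- (* The zero subcomplex is added to the chain, which may be empty. *)
  pose C' : set (subcomplex M) := fun L => exists2 t : T,
    C t \/ t = t0 & L = projT1 t.
  have C'_total : total_on C' sub_le.
    have t0_le (t : T) : sub_le (projT1 t0) (projT1 t).
      by move=> i x /eqP ->; apply: rpred0.
    move=> _ _ [s Cs ->] [t Ct ->].
    case: Cs => [Cs | ->]; last by left.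
    case: Ct => [Ct | ->]; last by right.
    by have [/asboolP | /asboolP] := C_total s t Cs Ct; [left | right].
  have C'_nonempty : exists L, C' L by exists (projT1 t0), t0; first by right.
  have C'_pure L : C' L -> cyclic_pure L by case=> t _ ->; apply: (projT2 t).
  exists (exist _ _ (union_cyclic_pure C'_total C'_nonempty C'_pure)) => s Cs.
  apply/asboolP => i x sx; apply/union_subP.
  by exists (projT1 s); first by exists s; first left.
exists L => // K pureK LK.
by have /asboolP := L_max (exist _ K pureK) (introT (asboolP _) LK).
Qed.

Section Preimage.
Variables (M : complex R) (L : subcomplex M) (K : subcomplex (quot_complex L)).

Definition preim_sub i : {pred M i} := fun x => quot_proj (L i) x \in K i.
Arguments preim_sub : clear implicits.

Lemma preim_sub_closed i : submod_closed (preim_sub i).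
Proof.
split=> [|c x y Kx Ky]; rewrite unfold_in /preim_sub.
  by rewrite linear0 rpred0.
by rewrite linearP rpredD ?rpredZ.
Qed.
HB.instance Definition _ i :=
  GRing.isSubmodClosed.Build R (M i) (preim_sub i) (preim_sub_closed i).

Lemma preim_sub_diff i x :
  x \in preim_sub i -> diff M i x \in preim_sub (i - 1).
Proof.
move=> Kx; rewrite unfold_in /preim_sub quot_complex_proj_diff.
exact: (sub_diff (s := K)).
Qed.

Definition preim_subcomplex : subcomplex M :=
  @Subcomplex R M (fun i => preim_sub i : submodClosed (M i)) preim_sub_diff.

Lemma preim_subD i x y :
  x \in preim_sub i -> y \in L i -> x + y \in preim_sub i.
Proof.
move=> Kx Ly; rewrite unfold_in /preim_sub quot_projD.
by rewrite (iffRL (quot_proj_eq0 _ y) Ly) addr0.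
Qed.

(** Stability under extensions, for the preimage in M of a subcomplex K of M/L.
    To lift a cycle w killed by c, take v in M lifting, modulo L, an element of
    K that is killed by c and has boundary w. Then c v = c l with l in L, and
    m = d l - (d v - w) is a cycle of L killed by c. Hence m = d m' with m' in L
    killed by c, and v + (m' - l) has boundary w and is killed by c. *)
Lemma preim_cyclic_pure :
    cyclic_pure L -> pure_acyclic (sub_complex K) -> pure_subcomplex K ->
  cyclic_pure preim_subcomplex.
Proof.
move=> pureL [_ acK] pureK; split=> [c i w Kw dw cw | c i v Kcv].
  (* The image of w, as a cycle of K killed by c. *)
  pose wK : sub_complex K (i - 1) := Sub (quot_proj (L (i - 1)) w) Kw.
  have wKZ : wK \in cycles (sub_complex K) (i - 1).
    apply/eqP/val_inj; rewrite [LHS]/= -quot_complex_proj_diff dw.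
    exact: linear0.
  have cwK : c *: (Sub wK wKZ : submod (cycles (sub_complex K) (i - 1))) = 0.
    apply/val_inj/val_inj; rewrite /= -[LHS]quot_projZ cw; exact: linear0.
  (* A preimage killed by c in K, and a representative v of it in M. *)
  have [v' /(congr1 (val \o val))/= dv' /(congr1 val)/= cv'] :=
    pure_lift_ann (acK i) cwK.
  pose v := quot_repr (val v').
  have vE : quot_proj (L i) v = val v' by apply: quot_reprK.
  have Kv : v \in preim_sub i by rewrite unfold_in /preim_sub vE; apply: valP.
  have Lcv : c *: v \in L i.
    by apply/quot_proj_eq0; rewrite -[LHS]/(_ (c *: v)) quot_projZ vE.
  have Ldv : diff M i v - w \in L (i - 1).
    by apply/quot_projP; rewrite quot_complex_proj_diff vE.
  have [l Ll lE] := cyclic_pure_div pureL Lcv.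
  pose m := diff M i l - (diff M i v - w).
  have Lm : m \in L (i - 1) by apply: submodB => //; apply: sub_diff.
  have dm : diff M (i - 1) m = 0 by rewrite !linearB !diff_diff dw !subrr addr0.
  have cm : c *: m = 0.
    by rewrite !scalerBr -!linearZ lE cw subr0 subrr.
  have [m' [Lm' dm' cm']] := cyclic_pure_lift pureL Lm dm cm.
  exists (v + (m' - l)); split.
  - by apply: preim_subD => //; apply: submodB.
  - by rewrite linearD linearB dm' /m addrAC subrr add0r subKr.
  - by rewrite scalerDr scalerBr cm' lE sub0r subrr.
have [|k' Kk' k'E] :=
  @pure_sub_ann R c i (quot_complex L) K (quot_proj (L i) v) pureK.
  by rewrite -[X in X \in _]quot_projZ.
pose k := quot_repr k'.
have kE : quot_proj (L i) k = k' by apply: quot_reprK.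
have [|l Ll lE] := @cyclic_pure_div _ _ pureL c i (v - k).
  by rewrite scalerBr; apply/quot_projP; rewrite !quot_projZ kE.
exists (k + l); last by rewrite scalerDr lE scalerBr addrC subrK.
by apply: preim_subD => //; rewrite unfold_in /preim_sub kE.
Qed.

End Preimage.

Lemma acyclic_quot M (L : subcomplex M) :
  acyclic M -> cyclic_pure L -> acyclic (quot_complex L).
Proof.
move=> acM pureL i z dz; pose x := quot_repr z.
have xE : quot_proj (L (i - 1)) x = z by apply: quot_reprK.
have Ldx : diff M (i - 1) x \in L (i - 1 - 1).
  by apply/quot_proj_eq0; rewrite quot_complex_proj_diff xE; apply/eqP.
have [l [Ll dl _]] :=
  cyclic_pure_lift pureL Ldx (diff_diff x) (scale0r _).
have [y dy] : exists y, diff M i y = x - l.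
  by apply: acM; apply/eqP; rewrite linearB dl subrr.
exists (quot_proj (L i) y).
rewrite -quot_complex_proj_diff dy -xE; apply/quot_projP.
by rewrite addrAC subrr sub0r submodN.
Qed.

(** Let L be maximal among the cyclically pure subcomplexes of M. The preimage
    of a pure-acyclic pure subcomplex of M/L is cyclically pure and contains L,
    so M/L is pure-minimal. As M/L is also acyclic, it vanishes, and M has the
    lifting property of cyclically pure subcomplexes. *)
Lemma acyclic_lift_ann M :
    (forall N : complex R, acyclic N -> pure_minimal N -> is_zero N) ->
    acyclic M ->
  forall c i (w : M (i - 1)), diff M (i - 1) w = 0 -> c *: w = 0 ->
  exists2 v, diff M i v = w & c *: v = 0.
Proof.
move=> min0 acM c i w dw cw.
have [L pureL L_max] := maximal_cyclic_pure M.
have quot0 : is_zero (quot_complex L).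
  apply: min0; first exact: acyclic_quot.
  move=> K; split=> [[acK pureK] | K0]; last first.
    by split; [apply: zero_pure_acyclic | apply: zero_pure_subcomplex].
  have pre_le : sub_le (preim_subcomplex K) L.
    apply: L_max => [|k y Ly]; first exact: preim_cyclic_pure.
    rewrite unfold_in /preim_sub /= (iffRL (quot_proj_eq0 _ y) Ly).
    exact: rpred0.
  move=> k y; apply/val_inj => /=.
  rewrite -[val y]quot_reprK; apply/quot_proj_eq0/pre_le.
  rewrite unfold_in /= /preim_sub quot_reprK; exact: valP.
have Lw : w \in L (i - 1) by apply/quot_proj_eq0/quot0.
by have [v [_ dv cv]] := cyclic_pure_lift pureL Lw dw cw; exists v.
Qed.

End CyclicPurity.

(** * The complex attached to a submodule *)

Section SubmoduleComplex.
Variables (R : pzRingType) (V : lmodType R) (S : submodClosed V).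

(** The sum of all shifts of the exact complex 0 -> S -> V -> V/S -> 0. All its
    terms and differentials are the same, whatever the degree. *)
Definition ses_sum : lmodType R := (submod S * V * quotmod S)%type.
Definition ses_diff (t : ses_sum) : ses_sum :=
  (0, submod_incl t.1.1, quot_proj S t.1.2).

Lemma ses_diff_linear : linear ses_diff.
Proof.
move=> c x y; congr (_, _, _).
- exact/esym/(etrans (addr0 _))/scaler0.
- exact: linearP.
Qed.
HB.instance Definition _ :=
  GRing.isLinear.Build R ses_sum ses_sum _ ses_diff ses_diff_linear.

Lemma ses_diff_diff t : ses_diff (ses_diff t) = 0.
Proof.
congr (_, _, _); apply/quot_proj_eq0; exact: valP.
Qed.

Definition ses_complex : complex R :=
  @Complex R (fun=> ses_sum) (fun=> ses_diff) (fun=> ses_diff_diff).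

Lemma ses_complex_acyclic : acyclic ses_complex.
Proof.
move=> i [[x y] z] /eqP[x0 /quot_proj_eq0 Sy].
exists (Sub y Sy, quot_repr z, 0); congr (_, _, _); last exact: quot_reprK.
exact/val_inj/esym.
Qed.

End SubmoduleComplex.

(** In the complex attached to Ra, the class of 1 in R/Ra is a cycle killed by
    a. A lift killed by a is some y = 1 + r a with a y = 0, that is
    a (- r) a = a. *)
Lemma minimal_acyclic_regular (R : pzRingType) :
    (forall M : complex R, acyclic M -> pure_minimal M -> is_zero M) ->
  von_neumann_regular R.
Proof.
move=> min0 a; pose S : submodClosed R^o := principal a.
pose w : ses_sum S := (0, 0, cyclic_class a 1).
have [||t dt at0] :=
    @acyclic_lift_ann R (ses_complex S) min0 (@ses_complex_acyclic _ _ S) a 0 w.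
- by congr (_, _, _); apply: linear0.
- by congr (_, _, _); rewrite ?scaler0 //; apply: cyclic_class_ann.
pose y := t.1.2; have ay : a * y = 0 := congr1 (fun u : ses_sum S => u.1.2) at0.
have /quot_projP/principalP[r rE] : quot_proj S y = cyclic_class a 1.
  exact: (congr1 (fun u : ses_sum S => u.2) (dt : ses_diff t = w)).
exists (- r).
have : a * (y - 1) = a * (r * a) by rewrite rE.
by rewrite mulrBr ay mulr1 sub0r mulrA mulrN mulNr => <-; rewrite opprK.
Qed.

Theorem mainTheorem7 (R : pzRingType) :
  [<-> von_neumann_regular R;
       forall M : complex R, (acyclic M /\ pure_minimal M) <-> is_zero M;
       forall M : complex R,
         pure_minimal M <->
         (forall L : subcomplex M,
            acyclic (sub_complex L) <-> is_zero (sub_complex L))].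
Proof.
have regular_sub : von_neumann_regular R -> forall M : complex R,
    pure_minimal M <->
    (forall L : subcomplex M,
       acyclic (sub_complex L) <-> is_zero (sub_complex L)).
  move=> reg M; split=> [minM L | acM L].
    split=> [acL | /zero_acyclic//]; apply/minM; split.
      exact: regular_acyclic_pure.
    exact: regular_acyclic_pure_subcomplex.
  split=> [[[acL _] _] | L0]; first exact/acM.
  by split; [apply: zero_pure_acyclic | apply: zero_pure_subcomplex].
have sub_min : (forall M : complex R,
      pure_minimal M <->
      (forall L : subcomplex M,
         acyclic (sub_complex L) <-> is_zero (sub_complex L))) ->
    forall M : complex R, (acyclic M /\ pure_minimal M) <-> is_zero M.
  move=> sub0 M; split=> [[acM /sub0 minM] | M0]; last first.
    by split; [apply: zero_acyclic | apply: zero_pure_minimal].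
  have [full0 _] := minM (full_subcomplex M).
  have /full0 M0 : acyclic (sub_complex (full_subcomplex M)).
    move=> i z /eqP/(congr1 val)/= dz.
    have [|x dx] := acM i (val z); first exact/eqP.
    by exists (Sub x isT); apply: val_inj.
  by move=> i x; have /(congr1 val) := M0 i (Sub x isT).
have min_regular :
    (forall M : complex R, (acyclic M /\ pure_minimal M) <-> is_zero M) ->
    von_neumann_regular R.
  by move=> min0; apply: minimal_acyclic_regular => M acM minM; apply/min0.
tfae.
- by move/regular_sub/sub_min.
- by move/min_regular/regular_sub.
- by move/sub_min/min_regular.
Qed.
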